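(* Let $n,m\in\mathbb{N}$ and let $X_1,\dots,X_n$ and $Y_1,\dots,Y_m$ be real-valued random variables on a common probability space, with distributions $F_1,\dots,F_n$ and $G_1,\dots,G_m$ respectively. Suppose that the two sequences $\{X_1,\dots,X_n\}$, $\{Y_1,\dots,Y_m\}$ are generalized quasi asymptotically independent (GQAI), and that $(X_i,Y_j)\in\mathcal{C}^{(2)}$ for every $i=1,\dots,n$ and $j=1,\dots,m$. Then, as $x\wedge y\to\infty$, $$\mathbf{P}[S_n>x,\,T_m>y]\sim\mathbf{P}\Big[\bigvee_{i=1}^n S_i>x,\ \bigvee_{j=1}^m T_j>y\Big]\sim\sum_{i=1}^n\sum_{j=1}^m\mathbf{P}[X_i>x,\,Y_j>y].$$
   Context: Notation: $S_k=\sum_{i=1}^k X_i$, $T_l=\sum_{j=1}^l Y_j$, $\bigvee_{i=1}^n S_i=\max_{1\le k\le n}S_k$, $\bigvee_{j=1}^m T_j=\max_{1\le l\le m}T_l$, $x\wedge y=\min\{x,y\}$. For positive functions $f,g$ of two variables, $f\sim g$ as $x\wedge y\to\infty$ means $\lim_{x\wedge y\to\infty} f(x,y)/g(x,y)=1$. The tail of a distribution $F$ is $\overline F(x)=1-F(x)$; all distributions of the $X_i$ and $Y_j$ satisfy $\overline F(x)>0$ for all $x\in\mathbb{R}$. Ratios involving joint tails presuppose that the joint tail in the denominator is positive. Class $\mathcal{C}$ (consistently varying): $F\in\mathcal{C}$ if $\lim_{z\uparrow1}\limsup_{x\to\infty}\overline F(zx)/\overline F(x)=1$. Class $\mathcal{C}^{(2)}$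 (bi-variate consistently varying): a random pair $(X,Y)$ with marginal distributions $F,G$ satisfies $(X,Y)\in\mathcal{C}^{(2)}$ if $F\in\mathcal{C}$, $G\in\mathcal{C}$ and $$\lim_{(z_1,z_2)\uparrow(1,1)}\ \limsup_{x\wedge y\to\infty}\frac{\mathbf{P}[X>z_1x,\,Y>z_2y]}{\mathbf{P}[X>x,\,Y>y]}=1.$$ GQAI: two sequences $\{X_1,\dots,X_n\}$, $\{Y_1,\dots,Y_m\}$ are GQAI if $$\lim_{x\wedge y\to\infty}\frac{\mathbf{P}[|X_i|>x,\,X_k>x,\,Y_j>y]}{\mathbf{P}[X_i>x,\,Y_j>y]+\mathbf{P}[X_k>x,\,Y_j>y]}=0$$ for all $i,k\in\{1,\dots,n\}$ with $i\ne k$ and all $j\in\{1,\dots,m\}$, and $$\lim_{x\wedge y\to\infty}\frac{\mathbf{P}[|Y_j|>y,\,Y_k>y,\,X_i>x]}{\mathbf{P}[X_i>x,\,Y_j>y]+\mathbf{P}[X_i>x,\,Y_k>y]}=0$$ for all $j,k\in\{1,\dots,m\}$ with $j\ne k$ and all $i\in\{1,\dots,n\}$. *)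

(* Defs.v *)
From HB Require Import structures.
From mathcomp Require Import all_boot all_order all_algebra.
From mathcomp Require Import all_classical all_reals all_analysis.

Set Implicit Arguments.
Unset Strict Implicit.
Unset Printing Implicit Defensive.

Import Order.TTheory GRing.Theory Num.Theory.
Import numFieldNormedType.Exports.

Local Open Scope classical_set_scope.
Local Open Scope ring_scope.

(* The filter "x /\ y --> +oo" on pairs of reals: its basic sets are the
   {(x, y) | M < min x y}. *)
Definition min_pinfty (R : realType) : set_system (R * R) :=
  filter_from setT (fun M : R => [set xy : R * R | M < Num.min xy.1 xy.2]).
Arguments min_pinfty R : clear implicits.

Global Instance min_pinfty_filter (R : realType) :
  ProperFilter (min_pinfty R).
Proof.
apply: filter_from_proper; last first.
  by move=> M _; exists (M + 1, M + 1); rewrite /= minxx ltrDl.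
apply: filter_from_filter; first by exists 0.
move=> M N _ _; exists (Num.max M N) => // xy /=.
by rewrite gt_max => /andP[].
Qed.

(* f ~ g as x /\ y --> +oo.  Since u / 0 = 0, the limit being 1 already forces
   f and g to be nonzero as soon as x /\ y is large enough. *)
Definition asymp_equiv (R : realType) (f g : R -> R -> R) : Prop :=
  f xy.1 xy.2 / g xy.1 xy.2 @[xy --> min_pinfty R] --> (1 : R).

Definition tail (R : realType) (F : R -> R) (x : R) : R := 1 - F x.

(* The class C.  The limsup is taken in \bar R, as it may be +oo for z < 1. *)
Definition consistently_varying (R : realType) (F : R -> R) : Prop :=
  (forall x, 0 < tail F x) /\
  limf_esup (fun x : R => (tail F (z * x) / tail F x)%:E) (+oo%R : set_system R)
    @[z --> (1 : R)^'-] --> 1%E.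

Section RandomVariables.
Context d (T : measurableType d) (R : realType) (P : probability T R).

Definition prob (A : set T) : R := fine (P A).

Definition joint_tail (X Y : T -> R) (x y : R) : R :=
  prob [set w | x < X w /\ y < Y w].

Definition df (X : {RV P >-> R}) (x : R) : R := fine (cdf X x).

(* The class C^(2).  Positivity of the joint tail is what the ratio
   presupposes; as the joint tail is nonincreasing in x and in y, asking it for
   all x and y amounts to asking it for x /\ y large. *)
Definition bivariate_consistently_varying (X Y : {RV P >-> R}) : Prop :=
  [/\ consistently_varying (df X),
      consistently_varying (df Y),
      forall x y, 0 < joint_tail X Y x y
    & limf_esup (fun xy : R * R =>
          (joint_tail X Y (z.1 * xy.1) (z.2 * xy.2)
             / joint_tail X Y xy.1 xy.2)%:E) (min_pinfty R)
        @[z --> ((1 : R)^'-, (1 : R)^'-)] --> 1%E].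

(* A ratio tends to 0 as x /\ y --> +oo, its denominator being positive. *)
Definition negligible_ratio (f g : R -> R -> R) : Prop :=
  (forall x y, 0 < g x y) /\
  f xy.1 xy.2 / g xy.1 xy.2 @[xy --> min_pinfty R] --> (0 : R).

Definition GQAI n m (X : 'I_n -> {RV P >-> R}) (Y : 'I_m -> {RV P >-> R}) :
    Prop :=
  (forall (i k : 'I_n) (j : 'I_m), i != k ->
     negligible_ratio
       (fun x y => prob [set w | [/\ x < `|X i w|, x < X k w & y < Y j w]])
       (fun x y => joint_tail (X i) (Y j) x y + joint_tail (X k) (Y j) x y)) /\
  (forall (j k : 'I_m) (i : 'I_n), j != k ->
     negligible_ratio
       (fun x y => prob [set w | [/\ y < `|Y j w|, y < Y k w & x < X i w]])
       (fun x y => joint_tail (X i) (Y j) x y + joint_tail (X i) (Y k) x y)).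

(* The indices of 'I_n start at 0: partial_sum X k is the sum of the first
   k + 1 variables. *)
Definition partial_sum n (X : 'I_n -> {RV P >-> R}) (k : 'I_n) (w : T) : R :=
  \sum_(i < n | (i <= k)%N) X i w.

Definition total_sum n (X : 'I_n -> {RV P >-> R}) (w : T) : R :=
  \sum_(i < n) X i w.

(* The maximum is taken in \bar R, where -oo is neutral for it; it is a real
   number whenever 0 < n. *)
Definition max_partial_sum n (X : 'I_n -> {RV P >-> R}) (w : T) : \bar R :=
  \big[maxe/-oo%E]_(k < n) (partial_sum X k w)%:E.

Definition max_joint_tail n m (X : 'I_n -> {RV P >-> R})
    (Y : 'I_m -> {RV P >-> R}) (x y : R) : R :=
  prob [set w | (x%:E < max_partial_sum X w)%E /\
                (y%:E < max_partial_sum Y w)%E].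

End RandomVariables.

(* Main.v *)
Require Import Defs.
From mathcomp Require Import all_boot all_order all_algebra.
From mathcomp Require Import all_classical all_reals all_analysis.
From mathcomp Require Import ring lra.
Import Order.TTheory GRing.Theory Num.Theory.
Import numFieldNormedType.Exports.
Local Open Scope classical_set_scope.
Local Open Scope ring_scope.

(** Let H (x, y) be the double sum of the joint tails P[X_i > x, Y_j > y]. The
    idea is the principle of a single big jump, in each coordinate: up to
    events that are negligible with respect to H, a sum of the X_i exceeds x
    only because exactly one X_i does, and likewise for the Y_j.

    Fix z slightly below 1 and put eps = (1 - z) / (n + m). Two facts about
    finite families of reals carry the reduction. If some subfamily has sum
    larger than x, then either one term exceeds z x or two distinct terms exceed
    eps x ([large_sum_one_or_two_large]). Conversely, if one term exceeds x / z
    while all the others are at most eps x in absolute value, then the sum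
    exceeds x ([one_large_sum_large]). Call [collision] i j the event that X_i
    and Y_j are large together with a third variable that is large in absolute
    value, and E the sum of the probabilities of these events. Writing J for
    the joint tail of the total sums and M for that of the maxima of the partial
    sums, the union bound gives
      M (x, y) <= H (z x, z y) + E (eps x, eps y)
    ([max_joint_tail_le]), and since the single-jump events are disjoint,
      H (x / z, y / z) <= J (x, y) + E (eps x, eps y)
    ([joint_tail_total_sum_ge]).

    Asymptotics enter only now. Consistent variation makes H (z x, z y) at most
    (1 + eta) H (x, y) for z close to 1
    ([tail_sum_consistently_varying]); iterating this for one z yields dominated
    variation, H (eps x, eps y) <= C H (x, y) for any eps > 0
    ([tail_sum_dominatedly_varying]). GQAI says that E (x, y) is o(H (x, y)), and
    dominated variation turns this into E (eps x, eps y) = o(H (x, y))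
    ([scaled_collision_sum_negligible]). As the total sum is the last partial
    sum, J <= M, so that
      (1 - eta) H <= J <= M <= (1 + eta) H
    eventually, which contains both equivalences. *)

Set Implicit Arguments.
Unset Strict Implicit.
Unset Printing Implicit Defensive.

(** * One large term in a finite family of reals *)

Section Deterministic.
Context (R : realType) (n : nat) (a : 'I_n -> R) (z eps x : R).
Context (z0 : 0 < z) (z1 : z < 1) (eps0 : 0 <= eps) (x0 : 0 < x).
Context (epsn : eps * n%:R <= 1 - z).

Let rest_le : eps * x * n%:R <= (1 - z) * x.
Proof. by rewrite mulrAC ler_pM2r. Qed.

Let zx_gt0 : 0 < z * x.
Proof. exact: mulr_gt0. Qed.

(** If no term exceeds [z * x] and at most one exceeds [eps * x], then the sum
    is at most [z * x + n * eps * x], and [eps * n <= 1 - z] makes this at most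
    [x]. Allowing an arbitrary subfamily covers all partial sums at once. *)
Lemma large_sum_one_or_two_large (p : pred 'I_n) :
  x < \sum_(i | p i) a i ->
  (exists i, z * x < a i) \/
  exists i k, [/\ i != k, eps * x < a i & eps * x < a k].
Proof.
move=> xs; apply: contrapT => /not_orP[none1 none2].
have le1 i : a i <= z * x by rewrite leNgt; apply/negP => ?; apply: none1; exists i.
have [i0|noi] := pselect (exists i, eps * x < a i); last first.
  have : \sum_(i | p i) a i <= \sum_(i < n) eps * x.
    rewrite (big_mkcond p) ler_sum// => i _.
    case: ifP => _; last by rewrite mulr_ge0// ltW.
    by rewrite leNgt; apply/negP => ?; apply: noi; exists i.
  rewrite sumr_const card_ord -mulr_natr; move: rest_le zx_gt0 xs; lra.
have {i0}[i ei] := i0.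
have : \sum_(i | p i) a i <= z * x + \sum_(k < n) eps * x.
  rewrite (big_mkcond p) (bigD1 i)//= lerD//.
    by case: ifP => _ //; rewrite mulr_ge0 ?ltW.
  rewrite [leRHS](bigD1 i)//= -[leLHS]add0r lerD//; first by rewrite mulr_ge0 // ltW.
  rewrite ler_sum// => k ki.
  case: ifP => _; last by rewrite mulr_ge0// ltW.
  rewrite leNgt; apply/negP => ?; apply: none2; exists i, k; split => //.
  by rewrite eq_sym.
rewrite sumr_const card_ord -mulr_natr; move: rest_le zx_gt0 xs; lra.
Qed.

(** The other terms cannot pull the sum down by more than [(1 - z) * x], while
    the large one overshoots [x] by at least that much, as
    [2 - z <= z^-1]. *)
Lemma one_large_sum_large (i : 'I_n) :
  z^-1 * x < a i -> (forall k, k != i -> `|a k| <= eps * x) ->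
  x < \sum_k a k.
Proof.
move=> xi small; rewrite (bigD1 i)//=.
have rest : \sum_(k < n) - (eps * x) <= \sum_(k | k != i) a k.
  rewrite (bigD1 i)//= -[leRHS]add0r lerD//.
    by rewrite oppr_le0 mulr_ge0 // ltW.
  by apply: ler_sum => k ki; have := small k ki; rewrite ler_norml => /andP[].
have zv : 2 - z <= z^-1.
  by rewrite -[leRHS]mul1r ler_pdivlMr//; have := sqr_ge0 (1 - z); rewrite expr2; lra.
move: rest; rewrite sumr_const card_ord -mulr_natr => rest.
have : (2 - z) * x <= z^-1 * x by rewrite ler_pM2r.
move: rest_le zx_gt0; lra.
Qed.

End Deterministic.

(** * Limits of ratios as both coordinates tend to infinity *)

Section Filter.
Context (R : realType).

Lemma min_pinfty_gt (M : R) :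
  \forall xy \near min_pinfty R, M < xy.1 /\ M < xy.2.
Proof. by exists M => // xy /=; rewrite lt_min => /andP[]. Qed.

Lemma min_pinfty_scale (c : R) (Q : R * R -> Prop) : 0 < c ->
  (\forall xy \near min_pinfty R, Q xy) ->
  \forall xy \near min_pinfty R, Q (c * xy.1, c * xy.2).
Proof.
move=> c0 [M _ MQ]; exists (c^-1 * M) => // xy /=; rewrite lt_min => /andP[Mx My].
apply: MQ => /=.
by rewrite lt_min -!(ltr_pdivrMl _ _ c0) Mx.
Qed.

(** Clearing the positive denominator, a limit of ratios becomes a family of
    linear inequalities, which are stable under the finite sums and the
    rescalings used below. *)
Lemma ratio_cvgP (l : R) (f g : R -> R -> R) :
  (\forall xy \near min_pinfty R, 0 < g xy.1 xy.2) ->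
  f xy.1 xy.2 / g xy.1 xy.2 @[xy --> min_pinfty R] --> l <->
  forall eta, 0 < eta -> \forall xy \near min_pinfty R,
    `|f xy.1 xy.2 - l * g xy.1 xy.2| <= eta * g xy.1 xy.2.
Proof.
move=> g0.
have E xy : 0 < g xy.1 xy.2 -> forall eta,
    (`|l - f xy.1 xy.2 / g xy.1 xy.2| <= eta) =
    (`|f xy.1 xy.2 - l * g xy.1 xy.2| <= eta * g xy.1 xy.2).
  move=> gp eta; rewrite -(ler_pM2r gp).
  rewrite -[X in _ * X <= _](gtr0_norm gp) -normrM mulrBl divfK ?gt_eqF//.
  by rewrite distrC.
split=> [/cvgrPdist_le h eta /h|h].
  by apply: filterS2 g0 => xy /E ->.
by apply/cvgrPdist_le => eta /h; apply: filterS2 g0 => xy /E ->.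
Qed.

Lemma asymp_equiv_squeeze (f g : R -> R -> R) :
  (\forall xy \near min_pinfty R, 0 < g xy.1 xy.2) ->
  (forall eta, 0 < eta -> \forall xy \near min_pinfty R,
    (1 - eta) * g xy.1 xy.2 <= f xy.1 xy.2 <= (1 + eta) * g xy.1 xy.2) ->
  asymp_equiv f g.
Proof.
move=> g0 h; apply/(ratio_cvgP _ _ g0) => eta /h; apply: filterS => xy.
by rewrite ler_norml mul1r; lra.
Qed.

End Filter.

(** * Finite probability bounds *)

Section Prob.
Context d (T : measurableType d) (R : realType) (P : probability T R).

Lemma prob_fineK A : measurable A -> (prob P A)%:E = P A.
Proof. by move=> mA; rewrite /prob fineK// fin_num_measure. Qed.

Lemma prob_ge0 A : 0 <= prob P A.
Proof. by rewrite /prob fine_ge0. Qed.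

Lemma prob_le A B : measurable A -> measurable B -> A `<=` B ->
  prob P A <= prob P B.
Proof. by move=> mA mB AB; rewrite -lee_fin !prob_fineK// le_measure ?inE. Qed.

Lemma prob_setU A B : measurable A -> measurable B ->
  prob P (A `|` B) <= prob P A + prob P B.
Proof.
move=> mA mB; rewrite -lee_fin EFinD !prob_fineK//; last exact: measurableU.
exact: measureU2.
Qed.

Lemma measurable_finite_bigcup (I : finType) (D : set I) (B : I -> set T) :
  (forall i, D i -> measurable (B i)) -> measurable (\bigcup_(i in D) B i).
Proof. by move=> mB; apply: fin_bigcup_measurable => //; exact: finite_finset. Qed.

Lemma prob_bigcup_le (I : finType) (D : pred I) (B : I -> set T) :
  (forall i, D i -> measurable (B i)) ->
  prob P (\bigcup_(i in [set i | D i]) B i) <= \sum_(i | D i) prob P (B i).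
Proof.
move=> mB.
have -> : \bigcup_(i in [set i | D i]) B i = \big[setU/set0]_(i | D i) B i.
  apply/seteqP; split=> [w [i Di Biw]|w].
    by rewrite (bigD1 i)//=; left.
  by elim/big_rec: _ => // i A Di IH [Bi|/IH//]; exists i.
have : measurable (\big[setU/set0]_(i | D i) B i) /\
    prob P (\big[setU/set0]_(i | D i) B i) <= \sum_(i | D i) prob P (B i).
  elim/big_rec2: _ => [|i A s Di [mA As]].
    by split; [exact: measurable0|rewrite /prob measure0].
  split; first by apply: measurableU => //; exact: mB.
  by rewrite (le_trans (prob_setU (mB _ Di) mA))// lerD2l.
by case.
Qed.

Lemma sum_prob_disjoint_le (I : finType) (B : I -> set T) A :
  measurable A -> (forall i, measurable (B i)) ->
  (forall i, B i `<=` A) -> trivIset setT B ->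
  \sum_i prob P (B i) <= prob P A.
Proof.
move=> mA mB BA tB.
apply: (@le_trans _ _ (prob P (\bigcup_(i in setT) B i))); last first.
  apply: prob_le => //; first exact: measurable_finite_bigcup.
  by move=> w [i _]; exact: BA.
rewrite -lee_fin prob_fineK; last exact: measurable_finite_bigcup.
rewrite measure_fin_bigcup//; last exact: finite_finset.
rewrite (fsbigE (index_enum I)) ?index_enum_uniq//=; last first.
  by move=> i; rewrite mem_index_enum.
rewrite -sumEFin (eq_bigl xpredT) => [|i]; last exact: in_setT.
by under [leRHS]eq_bigr do rewrite -prob_fineK//.
Qed.

Lemma measurable_gt (c : R) (f : T -> R) :
  measurable_fun setT f -> measurable [set w | c < f w].
Proof.
move=> mf; have := mf measurableT `]c, +oo[%classic (measurable_itv _).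
rewrite setTI; congr measurable.
by apply/seteqP; split => w /=; rewrite in_itv/= andbT.
Qed.

Lemma joint_tail_le (X Y : {RV P >-> R}) x x' y y' : x' <= x -> y' <= y ->
  joint_tail P X Y x y <= joint_tail P X Y x' y'.
Proof.
move=> xx yy; apply: prob_le; [| |by move=> w [? ?]; split; lra];
  by apply: measurableI; apply: measurable_gt; exact: measurable_funP.
Qed.

End Prob.

(** * Non-asymptotic bounds by sums of joint tails *)

Section JointSums.
Context d (T : measurableType d) (R : realType) (P : probability T R).
Context n m (X : 'I_n -> {RV P >-> R}) (Y : 'I_m -> {RV P >-> R}).

Lemma measurable_and3 (A B C : set T) :
  measurable A -> measurable B -> measurable C ->
  measurable [set w | [/\ A w, B w & C w]].
Proof.
move=> mA mB mC; rewrite [X in measurable X](_ : _ = A `&` (B `&` C)).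
  by do 2!apply: measurableI => //.
by apply/seteqP; split=> w; [case|case=> ? []].
Qed.

Lemma measurable_RV_gt (Z : {RV P >-> R}) c : measurable [set w | c < Z w].
Proof. by apply: measurable_gt; exact: measurable_funP. Qed.

Lemma measurable_RV_norm_gt (Z : {RV P >-> R}) c :
  measurable [set w | c < `|Z w|].
Proof.
apply: (@measurable_gt _ _ _ c (fun w => `|Z w|)).
by apply: measurableT_comp => //; exact: measurable_funP.
Qed.

Lemma measurable_sum_gt k (Z : 'I_k -> {RV P >-> R}) (p : pred 'I_k) c :
  measurable [set w | c < \sum_(i | p i) Z i w].
Proof.
apply: measurable_gt; under eq_fun do rewrite big_mkcond.
apply: measurable_sum => i; case: (p i); first exact: measurable_funP.
exact: measurable_cst.
Qed.

(** Turns the maximum in the extended reals into a finite union of events on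
    real-valued sums; the neutral element -oo exceeds no real number. *)
Lemma max_partial_sum_gtP k (Z : 'I_k -> {RV P >-> R}) c w :
  (c%:E < max_partial_sum Z w)%E <-> exists l, c < partial_sum Z l w.
Proof.
split=> [/bigmax_gtP[//|[l _]]|[l cl]]; first by exists l.
by apply/bigmax_gtP; right; exists l.
Qed.

Lemma measurable_max_partial_sum_gt k (Z : 'I_k -> {RV P >-> R}) c :
  measurable [set w | (c%:E < max_partial_sum Z w)%E].
Proof.
rewrite [X in measurable X](_ : _ =
    \bigcup_(l in setT) [set w | c < partial_sum Z l w]).
  by apply: measurable_finite_bigcup => l _; exact: measurable_sum_gt.
apply/seteqP; split=> w /=; first by move=> /max_partial_sum_gtP[l]; exists l.
by move=> [l _ cl]; apply/max_partial_sum_gtP; exists l.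
Qed.

Definition tail_sum x y :=
  \sum_(i < n) \sum_(j < m) joint_tail P (X i) (Y j) x y.

(** [X i] and [Y j] both exceed their thresholds and a third variable of either
    family is large in absolute value: the events whose probabilities GQAI
    controls. The third variable must be taken in absolute value because a very
    negative one could cancel the jump of [X i] or [Y j]. *)
Definition collision (i : 'I_n) (j : 'I_m) x y : set T :=
  \bigcup_(k in [set k | k != i])
    [set w | [/\ x < `|X k w|, x < X i w & y < Y j w]] `|`
  \bigcup_(l in [set l | l != j])
    [set w | [/\ y < `|Y l w|, y < Y j w & x < X i w]].

Definition collision_sum x y :=
  \sum_(i < n) \sum_(j < m) prob P (collision i j x y).

Lemma measurable_X_collision k i j x y :
  measurable [set w | [/\ x < `|X k w|, x < X i w & y < Y j w]].
Proof.
by apply: measurable_and3; [exact: measurable_RV_norm_gt|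
  exact: measurable_RV_gt|exact: measurable_RV_gt].
Qed.

Lemma measurable_Y_collision l j i x y :
  measurable [set w | [/\ y < `|Y l w|, y < Y j w & x < X i w]].
Proof.
by apply: measurable_and3; [exact: measurable_RV_norm_gt|
  exact: measurable_RV_gt|exact: measurable_RV_gt].
Qed.

Lemma measurable_collision i j x y : measurable (collision i j x y).
Proof.
apply: measurableU; apply: measurable_finite_bigcup => k _.
  exact: measurable_X_collision.
exact: measurable_Y_collision.
Qed.

Lemma measurable_joint_gt i j x y :
  measurable [set w | x < X i w /\ y < Y j w].
Proof. by apply: measurableI; exact: measurable_RV_gt. Qed.

Lemma joint_tail_le_tail_sum i j x y :
  joint_tail P (X i) (Y j) x y <= tail_sum x y.
Proof.
rewrite /tail_sum (bigD1 i)//= (bigD1 j)//= -addrA lerDl addr_ge0//.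
  by apply: sumr_ge0 => ? _; exact: prob_ge0.
by apply: sumr_ge0 => ? _; apply: sumr_ge0 => ? _; exact: prob_ge0.
Qed.

Lemma tail_sum_le x x' y y' : x' <= x -> y' <= y ->
  tail_sum x y <= tail_sum x' y'.
Proof.
by move=> xx yy; apply: ler_sum => i _; apply: ler_sum => j _;
  exact: joint_tail_le.
Qed.

Section Pointwise.
Context (z eps x y : R) (z0 : 0 < z) (z1 : z < 1) (eps0 : 0 < eps).
Context (epsz : eps <= z) (x0 : 0 < x) (y0 : 0 < y).
Context (epsn : eps * n%:R <= 1 - z) (epsm : eps * m%:R <= 1 - z).

(** Each coordinate shows either a single term beyond the factor [z] or two
    terms beyond the factor [eps]. A single jump in both coordinates is counted
    by a joint tail; in the three other cases there is a collision, and
    [eps <= z] ensures that the single jump, if any, is also beyond [eps]. *)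
Lemma max_joint_tail_le :
  max_joint_tail X Y x y <=
  tail_sum (z * x) (z * y) + collision_sum (eps * x) (eps * y).
Proof.
pose B (t : 'I_n * 'I_m) := [set w | z * x < X t.1 w /\ z * y < Y t.2 w] `|`
  collision t.1 t.2 (eps * x) (eps * y).
have mB t : measurable (B t).
  by apply: measurableU; [exact: measurable_joint_gt|exact: measurable_collision].
apply: (@le_trans _ _ (\sum_t prob P (B t))); last first.
  rewrite /tail_sum /collision_sum !pair_big -big_split/=.
  apply: ler_sum => t _; apply: prob_setU; first exact: measurable_joint_gt.
  exact: measurable_collision.
apply: le_trans (prob_bigcup_le P (D := xpredT) (fun t _ => mB t)).
apply: prob_le.
- by apply: measurableI; exact: measurable_max_partial_sum_gt.
- by apply: measurable_finite_bigcup.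
move=> w [/max_partial_sum_gtP[k xk] /max_partial_sum_gtP[l yl]].
have ex : eps * x <= z * x by rewrite ler_pM2r.
have ey : eps * y <= z * y by rewrite ler_pM2r.
have abs_gt (u c : R) : c < u -> c < `|u|.
  by move=> cu; exact: lt_le_trans cu (ler_norm _).
have := large_sum_one_or_two_large z0 (ltW eps0) x0 epsn xk.
have := large_sum_one_or_two_large z0 (ltW eps0) y0 epsm yl.
case=> [[j yj]|[j [l' [jl yj yl']]]] [[i xi]|[i [k' [ik xi xk']]]].
- by exists (i, j) => //; left.
- exists (i, j) => //; right; left; exists k'; first by rewrite /= eq_sym.
  by split=> //=; [exact: abs_gt|exact: le_lt_trans yj].
- exists (i, j) => //; right; right; exists l'; first by rewrite /= eq_sym.
  by split=> //=; [exact: abs_gt|exact: le_lt_trans xi].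
- exists (i, j) => //; right; left; exists k'; first by rewrite /= eq_sym.
  by split=> //=; exact: abs_gt.
Qed.

(** Outside of the collisions, a jump of [X i] and [Y j] beyond the factor
    [z^-1] leaves all the other variables small, so both sums are large. For
    different pairs (i, j) these single-jump events are disjoint, since a
    variable cannot be both small and large, so their probabilities add up to at
    most the joint tail of the sums. *)
Lemma joint_tail_total_sum_ge :
  tail_sum (z^-1 * x) (z^-1 * y) <=
  joint_tail P (total_sum X) (total_sum Y) x y +
  collision_sum (eps * x) (eps * y).
Proof.
(* The i-th variable is the only one that jumps beyond its threshold. *)
pose A k (Z : 'I_k -> {RV P >-> R}) i u := [set w | z^-1 * u < Z i w /\
  forall l, l != i -> `|Z l w| <= eps * u].
have mA k (Z : 'I_k -> {RV P >-> R}) i u : measurable (A k Z i u).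
  rewrite [X in measurable X](_ : _ = [set w | z^-1 * u < Z i w] `\`
      \bigcup_(l in [set l | l != i]) [set w | eps * u < `|Z l w|]).
    apply: measurableD; first exact: measurable_RV_gt.
    by apply: measurable_finite_bigcup => l _; exact: measurable_RV_norm_gt.
  apply/seteqP; split=> w [ui small]; split=> //.
    by move=> [l /= /small]; rewrite leNgt => /negP.
  move=> l li; rewrite leNgt; apply/negP => ul; apply: small.
  by exists l.
have epsvz : eps < z^-1.
  by rewrite (le_lt_trans epsz)// (lt_trans z1)// invf_gt1.
have tA k (Z : 'I_k -> {RV P >-> R}) i i' u w : 0 < u ->
    A k Z i u w -> A k Z i' u w -> i = i'.
  move=> u0 [ui _] [_ small]; apply: contrapT => /eqP/small.
  rewrite leNgt => /negP; apply; apply: lt_le_trans (ler_norm _).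
  by apply: lt_trans ui; rewrite ltr_pM2r.
pose B (t : 'I_n * 'I_m) := A n X t.1 x `&` A m Y t.2 y.
have mB t : measurable (B t) by apply: measurableI.
apply: (@le_trans _ _ (\sum_t prob P (B t) + collision_sum (eps * x) (eps * y))).
  rewrite /tail_sum /collision_sum !pair_big -big_split/=.
  apply: ler_sum => -[i j] _ /=.
  apply: le_trans (prob_setU P (mB _) (measurable_collision _ _ _ _)).
  apply: prob_le; first exact: measurable_joint_gt.
    by apply: measurableU => //; exact: measurable_collision.
  move=> w [xi yj].
  have exi : eps * x < X i w by apply: lt_trans xi; rewrite ltr_pM2r.
  have eyj : eps * y < Y j w by apply: lt_trans yj; rewrite ltr_pM2r.
  have [C|nC] := pselect (collision i j (eps * x) (eps * y) w); first by right.
  left; split; split=> // l li; rewrite leNgt; apply/negP => el; apply: nC.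
    by left; exists l.
  by right; exists l.
rewrite lerD2r; apply: sum_prob_disjoint_le => //.
- by apply: measurableI; exact: measurable_sum_gt.
- move=> t w [[xi Xs] [yj Ys]]; split.
    exact: (one_large_sum_large z0 (ltW eps0) x0 epsn xi Xs).
  exact: (one_large_sum_large z0 (ltW eps0) y0 epsm yj Ys).
- move=> [i j] [i' j'] _ _ [w [[Ai Aj] [Ai' Aj']]].
  by congr pair; [exact: tA x0 Ai Ai'|exact: tA y0 Aj Aj'].
Qed.

End Pointwise.

Lemma joint_tail_total_sum_le x y : (0 < n)%N -> (0 < m)%N ->
  joint_tail P (total_sum X) (total_sum Y) x y <= max_joint_tail X Y x y.
Proof.
have last_partial_sum k (Z : 'I_k -> {RV P >-> R}) c w : (0 < k)%N ->
    c < total_sum Z w -> (c%:E < max_partial_sum Z w)%E.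
  move=> k0 ck; apply/max_partial_sum_gtP.
  have kk : (k.-1 < k)%N by rewrite prednK.
  exists (Ordinal kk); rewrite /partial_sum (eq_bigl xpredT)// => i.
  by rewrite -ltnS prednK//= ltn_ord.
move=> n0 m0; apply: prob_le.
- by apply: measurableI; exact: measurable_sum_gt.
- by apply: measurableI; exact: measurable_max_partial_sum_gt.
by move=> w [? ?]; split; exact: last_partial_sum.
Qed.

End JointSums.

(** * Asymptotics of the sum of joint tails *)

Section Asymptotics.
Context d (T : measurableType d) (R : realType) (P : probability T R).

(** Restricting the limit to the diagonal [z1 = z2] and phrasing it as an
    eventual bound lets one factor [z] serve all pairs of variables. *)
Lemma bivariate_consistently_varying_near (U V : {RV P >-> R}) eta :
  bivariate_consistently_varying U V -> 0 < eta ->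
  \forall z \near (1 : R)^'-, \forall xy \near min_pinfty R,
    joint_tail P U V (z * xy.1) (z * xy.2) <=
    (1 + eta) * joint_tail P U V xy.1 xy.2.
Proof.
move=> [_ _ pos lim] eta0.
have lt1 : (1 < (1 + eta)%:E)%E by rewrite lte_fin ltrDl.
have [[A B] [/= nA nB] AB] := lim _ (open_ereal_lt' lt1).
apply: filterS2 nA nB => z Az Bz.
have /ereal_inf_lt[_ [W FW <-] supW] := AB (z, z) (conj Az Bz).
apply: filterS FW => xy Wxy.
rewrite -ler_pdivrMr ?pos// -lee_fin; apply: le_trans (ltW supW).
by apply: ereal_sup_ubound; exists xy.
Qed.

Context n m (X : 'I_n -> {RV P >-> R}) (Y : 'I_m -> {RV P >-> R}).
Context (CV : forall i j, bivariate_consistently_varying (X i) (Y j)).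
Context (GQ : GQAI X Y).

Local Notation H := (tail_sum X Y).

Lemma tail_sum_consistently_varying eta : 0 < eta ->
  exists z : R, [/\ 2^-1 <= z, z < 1 &
    \forall xy \near min_pinfty R,
      H (z * xy.1) (z * xy.2) <= (1 + eta) * H xy.1 xy.2].
Proof.
move=> eta0.
have near_ij : \forall z \near (1 : R)^'-, forall i j,
    \forall xy \near min_pinfty R,
      joint_tail P (X i) (Y j) (z * xy.1) (z * xy.2) <=
      (1 + eta) * joint_tail P (X i) (Y j) xy.1 xy.2.
  apply: filter_forall => i; apply: filter_forall => j.
  exact: bivariate_consistently_varying_near.
have half1 : 2^-1 < 1 :> R by rewrite invf_lt1// ltr1n.
have [z [[z12 z1] hz]] := filter_ex (filterI (filterI
  (nbhs_left_gt half1) (nbhs_left_lt (1 : R))) near_ij).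
exists z; split=> //; first exact: ltW.
have : \forall xy \near min_pinfty R, forall i j,
      joint_tail P (X i) (Y j) (z * xy.1) (z * xy.2) <=
      (1 + eta) * joint_tail P (X i) (Y j) xy.1 xy.2.
  by apply: filter_forall => i; apply: filter_forall => j; exact: hz.
apply: filterS => xy hxy; rewrite /tail_sum mulr_sumr; apply: ler_sum => i _.
by rewrite mulr_sumr; apply: ler_sum => j _; exact: hxy.
Qed.

(** Consistent variation gives the factor 2 for a single [z < 1]; iterating [k]
    times gives [2 ^+ k] for [z ^+ k], which drops below [eps]. *)
Lemma tail_sum_dominatedly_varying eps : 0 < eps ->
  exists2 C : R, 0 < C & \forall xy \near min_pinfty R,
    H (eps * xy.1) (eps * xy.2) <= C * H xy.1 xy.2.
Proof.
move=> eps0.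
have [z [z12 z1 hz]] := tail_sum_consistently_varying (@ltr01 R).
have z0 : 0 < z by apply: lt_le_trans z12; rewrite invr_gt0.
have [k zk] : exists k, z ^+ k < eps.
  have /cvgr0_norm_lt/(_ _ eps0) : (z ^+ k @[k --> \oo] --> (0 : R)).
    by apply: cvg_expr; rewrite gtr0_norm.
  move=> /filter_ex[k]; rewrite ger0_norm ?exprn_ge0 ?ltW// => zk.
  by exists k.
exists (2 ^+ k); first by rewrite exprn_gt0.
have hk : \forall xy \near min_pinfty R,
    H (z ^+ k * xy.1) (z ^+ k * xy.2) <= 2 ^+ k * H xy.1 xy.2.
  elim: k {zk} => [|k IH]; first by near=> xy; rewrite !expr0 !mul1r.
  apply: filterS2 IH (min_pinfty_scale (exprn_gt0 k z0) hz) => xy /= IH step.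
  rewrite !exprS -!mulrA (le_trans step)//.
  by rewrite (_ : 1 + 1 = 2)// ler_pM2l.
apply: filterS2 hk (min_pinfty_gt 0) => xy hk [x0 y0].
by apply: le_trans hk; apply: tail_sum_le; rewrite ler_pM2r// ltW.
Unshelve. all: by end_near. Qed.

Lemma sum_negligible (I : finType) (p : pred I) (f : I -> R -> R -> R) :
  (forall i, p i -> forall eta, 0 < eta -> \forall xy \near min_pinfty R,
    f i xy.1 xy.2 <= eta * H xy.1 xy.2) ->
  forall eta, 0 < eta -> \forall xy \near min_pinfty R,
    \sum_(i | p i) f i xy.1 xy.2 <= eta * H xy.1 xy.2.
Proof.
move=> hf eta eta0.
have c0 : 0 < eta / #|I|.+1%:R by rewrite divr_gt0.
have : \forall xy \near min_pinfty R, forall i, p i ->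
    f i xy.1 xy.2 <= eta / #|I|.+1%:R * H xy.1 xy.2.
  apply: filter_forall => i; have [pi|npi] := boolP (p i).
    by apply: filterS (hf i pi _ c0) => xy ? _.
  by near=> xy.
apply: filterS => xy hxy.
have H0 : 0 <= H xy.1 xy.2.
  by do 2!apply: sumr_ge0 => ? _; exact: prob_ge0.
apply: (@le_trans _ _ (\sum_(i : I) eta / #|I|.+1%:R * H xy.1 xy.2)).
  rewrite big_mkcond; apply: ler_sum => i _; case: ifP => [/hxy//|_].
  by rewrite mulr_ge0// ltW.
rewrite sumr_const -[leLHS]mulr_natr [leLHS]mulrAC ler_wpM2r//.
rewrite -mulrA ler_piMr//; first exact: ltW.
by rewrite mulrC ler_pdivrMr ?mul1r ?ler_nat// ltr0n.
Unshelve. all: by end_near. Qed.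

(** Each GQAI denominator is a sum of two joint tails, hence at most twice their
    total sum. *)
Lemma negligible_ratio_tail_sum (f : R -> R -> R) i i' j j' :
  negligible_ratio f (fun x y =>
    joint_tail P (X i) (Y j) x y + joint_tail P (X i') (Y j') x y) ->
  forall eta, 0 < eta -> \forall xy \near min_pinfty R,
    f xy.1 xy.2 <= eta * H xy.1 xy.2.
Proof.
set g := fun x y : R => _ + _; move=> [pos lim] eta eta0.
have eta20 : 0 < eta / 2 by rewrite divr_gt0.
have g0 : \forall xy \near min_pinfty R, 0 < g xy.1 xy.2.
  by apply: filterE => xy; exact: pos.
have := (ratio_cvgP 0 f g0).1 lim _ eta20.
apply: filterS => xy; rewrite mul0r subr0 => /(le_trans (ler_norm _)).
move=> /le_trans; apply; rewrite -mulrA ler_pM2l//.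
rewrite mulrC ler_pdivrMr// mulr_natr mulr2n.
by apply: lerD; exact: joint_tail_le_tail_sum.
Qed.

Lemma collision_sum_negligible eta : 0 < eta ->
  \forall xy \near min_pinfty R,
    collision_sum X Y xy.1 xy.2 <= eta * H xy.1 xy.2.
Proof.
move: eta; apply: (sum_negligible (p := xpredT) (f := fun i x y =>
  \sum_(j < m) prob P (collision X Y i j x y))) => i _.
apply: (sum_negligible (p := xpredT) (f := fun j x y =>
  prob P (collision X Y i j x y))) => j _ eta eta0.
have eta20 : 0 < eta / 2 by rewrite divr_gt0.
have nX := @sum_negligible _ (fun k => k != i) (fun k x y => prob P
  [set w | [/\ x < `|X k w|, x < X i w & y < Y j w]])
  (fun k ki => negligible_ratio_tail_sum (GQ.1 k i j ki)) _ eta20.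
have nY := @sum_negligible _ (fun l => l != j) (fun l x y => prob P
  [set w | [/\ y < `|Y l w|, y < Y j w & x < X i w]])
  (fun l lj => negligible_ratio_tail_sum (GQ.2 l j i lj)) _ eta20.
apply: filterS2 nX nY => xy nX nY.
rewrite [eta]splitr mulrDl; apply: le_trans (lerD nX nY).
apply: le_trans (prob_setU P _ _) _.
- by apply: measurable_finite_bigcup => k _; exact: measurable_X_collision.
- by apply: measurable_finite_bigcup => l _; exact: measurable_Y_collision.
apply: lerD; apply: prob_bigcup_le => k _.
  exact: measurable_X_collision.
exact: measurable_Y_collision.
Qed.

(** GQAI compares collisions with the joint tails at the same threshold [eps * x];
    dominated variation brings these back to the threshold [x]. *)
Lemma scaled_collision_sum_negligible eps eta : 0 < eps -> 0 < eta ->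
  \forall xy \near min_pinfty R,
    collision_sum X Y (eps * xy.1) (eps * xy.2) <= eta * H xy.1 xy.2.
Proof.
move=> eps0 eta0; have [C C0 hC] := tail_sum_dominatedly_varying eps0.
have etaC0 : 0 < eta / C by rewrite divr_gt0.
have := min_pinfty_scale eps0 (collision_sum_negligible etaC0).
apply: filterS2 hC => xy hC /= /le_trans; apply.
have -> : eta * H xy.1 xy.2 = eta / C * (C * H xy.1 xy.2).
  by rewrite mulrA divfK// gt_eqF.
by rewrite ler_pM2l.
Qed.

Lemma joint_tails_tail_sum eta : (0 < n)%N -> (0 < m)%N -> 0 < eta ->
  \forall xy \near min_pinfty R,
    (1 - eta) * H xy.1 xy.2 <=
      joint_tail P (total_sum X) (total_sum Y) xy.1 xy.2 /\
    max_joint_tail X Y xy.1 xy.2 <= (1 + eta) * H xy.1 xy.2.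
Proof.
move=> n0 m0 eta0.
have e20 : 0 < eta / 2 by rewrite divr_gt0.
have [z [z12 z1 hz]] := tail_sum_consistently_varying e20.
have z0 : 0 < z by apply: lt_le_trans z12; rewrite invr_gt0.
pose eps := (1 - z) / (n + m)%:R.
have nm0 : 0 < (n + m)%:R :> R by rewrite ltr0n addn_gt0 n0.
have eps0 : 0 < eps by rewrite divr_gt0// subr_gt0.
have eps_le k : (k <= n + m)%N -> eps * k%:R <= 1 - z.
  move=> k_le; rewrite /eps mulrAC ler_pdivrMr// ler_wpM2l ?ler_nat//.
  by rewrite subr_ge0 ltW.
have epsz : eps <= z.
  have := eps_le 1 (ltn_addr _ n0); rewrite mulr1; move: z12; lra.
have hn := eps_le n (leq_addr _ _).
have hm := eps_le m (leq_addl _ _).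
have zV0 : 0 < z^-1 by rewrite invr_gt0.
have small := scaled_collision_sum_negligible eps0 e20.
have pos := min_pinfty_gt (0 : R).
near=> xy.
have [x0 y0] : 0 < xy.1 /\ 0 < xy.2 by near: xy.
have sm : collision_sum X Y (eps * xy.1) (eps * xy.2) <= eta / 2 * H xy.1 xy.2.
  by near: xy.
have up : H (z * xy.1) (z * xy.2) <= (1 + eta / 2) * H xy.1 xy.2 by near: xy.
have low : H (z * (z^-1 * xy.1)) (z * (z^-1 * xy.2)) <=
    (1 + eta / 2) * H (z^-1 * xy.1) (z^-1 * xy.2).
  by near: xy; exact: (min_pinfty_scale zV0 hz).
rewrite !mulVKf ?gt_eqF// in low.
have upper := max_joint_tail_le X Y z0 eps0 epsz x0 y0 hn hm.
have lower := joint_tail_total_sum_ge X Y z0 z1 eps0 epsz x0 y0 hn hm.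
have H0 : 0 <= H xy.1 xy.2.
  by do 2!apply: sumr_ge0 => ? _; exact: prob_ge0.
split; last by move: upper sm up; lra.
have : (1 - eta / 2) * H xy.1 xy.2 <= H (z^-1 * xy.1) (z^-1 * xy.2).
  set a := H xy.1 xy.2 in low H0 *; set b := H _ _ in low *.
  have e2 : 0 < 1 + eta / 2 by rewrite addr_gt0.
  rewrite -(ler_pM2l e2) (le_trans _ low)// mulrA ler_piMl//.
  have := sqr_ge0 (eta / 2); rewrite expr2; lra.
by move: lower sm; lra.
Unshelve. all: by end_near. Qed.

End Asymptotics.

Unset Implicit Arguments.

Theorem theorem3p1 (d : measure_display) (T : measurableType d) (R : realType)
    (P : probability T R) (n m : nat)
    (X : 'I_n -> {RV P >-> R}) (Y : 'I_m -> {RV P >-> R}) :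
  (0 < n)%N -> (0 < m)%N ->
  GQAI X Y ->
  (forall (i : 'I_n) (j : 'I_m), bivariate_consistently_varying (X i) (Y j)) ->
  asymp_equiv (joint_tail P (total_sum X) (total_sum Y)) (max_joint_tail X Y) /\
  asymp_equiv (max_joint_tail X Y)
    (fun x y => \sum_(i < n) \sum_(j < m) joint_tail P (X i) (Y j) x y).
Proof.
move=> n0 m0 GQ CV.
have H_gt0 x y : 0 < tail_sum X Y x y.
  have [_ _ pos _] := CV (Ordinal n0) (Ordinal m0).
  exact: lt_le_trans (pos x y) (joint_tail_le_tail_sum X Y _ _ _ _).
have bounds eta := joint_tails_tail_sum CV GQ (eta := eta) n0 m0.
have JM xy := joint_tail_total_sum_le X Y xy.1 xy.2 n0 m0.
split; apply: asymp_equiv_squeeze.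
- (* Any eta < 1 makes the lower bound on the smaller tail positive. *)
  have half0 : 0 < 2^-1 :> R by rewrite invr_gt0.
  apply: filterS (bounds _ half0) => xy [lo _].
  by move: lo (JM xy) (H_gt0 xy.1 xy.2); lra.
- move=> eta eta0; have eta20 : 0 < eta / 2 by rewrite divr_gt0.
  apply: filterS (bounds _ eta20) => xy [lo up].
  have := JM xy; move: lo up (H_gt0 xy.1 xy.2).
  set J := joint_tail _ _ _ _ _; set M := max_joint_tail _ _ _ _.
  move=> lo up Hp JleM.
  have J0 : 0 <= J by exact: prob_ge0.
  have M0 : 0 <= M by exact: prob_ge0.
  apply/andP; split; last by rewrite (le_trans JleM)// ler_peMl// lerDl ltW.
  (* With the bounds taken at eta / 2, the lower estimate rests on
     (1 - eta) (1 + eta / 2) <= 1 - eta / 2. *)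
  have [eta1|eta1] := lerP 1 eta.
    by apply: le_trans J0; rewrite mulr_le0_ge0// subr_le0.
  apply: le_trans lo.
  apply: (le_trans (ler_wpM2l _ up)); first by rewrite subr_ge0 ltW.
  rewrite mulrA; apply: ler_wpM2r; first exact: ltW.
  have := sqr_ge0 eta; rewrite expr2; lra.
- by near=> xy; exact: H_gt0.
- move=> eta eta0; apply: filterS (bounds _ eta0) => xy [lo up].
  by rewrite (le_trans lo (JM xy)).
Unshelve. all: by end_near. Qed.
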